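(* Let $-\infty<a<b<\infty$, and let $C[a,b]$ be the (real or complex) Banach space of continuous functions on $[a,b]$ with the norm $\|f\|_\infty:=\max_{a\le x\le b}|f(x)|$. For every $n\in\mathbb{N}=\{1,2,\dots\}$, the $n$th derivative operator $$D^nf:=f^{(n)}$$ in $C[a,b]$ with maximal domain $D(D^n):=C^n[a,b]$ is a chaotic operator.
   Context: $C^n[a,b]$ denotes the space of $n$ times continuously differentiable functions on $[a,b]$ (with one-sided derivatives at the endpoints), real- or complex-valued according to the scalar field. Let $A$ be a (bounded or unbounded) linear operator in a (real or complex) Banach space $X$ with domain $D(A)\subseteq X$. Powers are taken with their natural domains, with $A^0:=I$ the identity operator, and $C^\infty(A):=\bigcap_{m=0}^\infty D(A^m)$. A nonzero vector $f\in C^\infty(A)$ is called hypercyclic for $A$ if its orbit $\{A^mf\}_{m=0}^\infty$ is dense in $X$; $A$ is called hypercyclic if it has a hypercyclic vector. A vector $f$ is called a periodic point of $A$ if there is an $N\in\mathbb{N}$ with $f\in D(A^N)$ and $A^Nf=f$. The operator $A$ is called chaotic if it is hypercyclic and the set $\operatorname{Per}(A)$ of its periodic points is dense in $X$. *)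

(* Defs.v *)
From Stdlib Require Import Reals Lra Lia FunctionalExtensionality
  PropExtensionality ProofIrrelevance ClassicalEpsilon.
From Coquelicot Require Import Coquelicot.
Open Scope R_scope.

(** A linear operator with domain in [X], given by its graph: [graph A f g]
    says that [f] is in the domain of [A] and [A f = g]. *)
Record linear_operator {K : AbsRing} (X : NormedModule K) := LinearOperator {
  graph : X -> X -> Prop;
  graph_functional : forall f g h, graph f g -> graph f h -> g = h;
  graph_zero : graph zero zero;
  graph_plus : forall f1 f2 g1 g2,
    graph f1 g1 -> graph f2 g2 -> graph (plus f1 f2) (plus g1 g2);
  graph_scal : forall (c : K) f g,
    graph f g -> graph (scal c f) (scal c g)
}.

Arguments graph {K X} A f g : rename.

Definition domain {K : AbsRing} {X : NormedModule K}
  (A : linear_operator X) (f : X) : Prop := exists g, graph A f g.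

(** [op_pow A m f g]: [f] is in the natural domain of [A^m] and [A^m f = g];
    [A^(m+1) f = A (A^m f)]. *)
Fixpoint op_pow {K : AbsRing} {X : NormedModule K}
  (A : linear_operator X) (m : nat) (f g : X) : Prop :=
  match m with
  | O => f = g
  | S m => exists h, op_pow A m f h /\ graph A h g
  end.

Definition C_infty {K : AbsRing} {X : NormedModule K}
  (A : linear_operator X) (f : X) : Prop :=
  forall m : nat, exists g, op_pow A m f g.

Definition orbit {K : AbsRing} {X : NormedModule K}
  (A : linear_operator X) (f : X) : X -> Prop :=
  fun g => exists m : nat, op_pow A m f g.

Definition dense {X : UniformSpace} (S : X -> Prop) : Prop :=
  forall (x : X) (eps : posreal), exists y : X, S y /\ ball x eps y.

Definition hypercyclic_vector {K : AbsRing} {X : CompleteNormedModule K}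
  (A : linear_operator X) (f : X) : Prop :=
  f <> zero /\ C_infty A f /\ dense (orbit A f).

Definition hypercyclic {K : AbsRing} {X : CompleteNormedModule K}
  (A : linear_operator X) : Prop := exists f, hypercyclic_vector A f.

Definition periodic_point {K : AbsRing} {X : NormedModule K}
  (A : linear_operator X) (f : X) : Prop :=
  exists N : nat, (1 <= N)%nat /\ op_pow A N f f.

Definition chaotic {K : AbsRing} {X : CompleteNormedModule K}
  (A : linear_operator X) : Prop :=
  hypercyclic A /\ dense (periodic_point A).

Record itv {a b : R} (hab : a < b) := Itv {
  pt :> R;
  pt_bounds : a <= pt <= b
}.

Arguments pt {a b hab} _.
Arguments pt_bounds {a b hab} _.

Section Interval.
Context {a b : R} (hab : a < b).

Lemma pt_inj (x y : itv hab) : pt x = pt y -> x = y.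
Proof.
destruct x as [x hx], y as [y hy]; simpl; intros E; subst y.
now rewrite (proof_irrelevance _ hx hy).
Qed.

Definition itv_left : itv hab :=
  Itv a b hab a (conj (Rle_refl a) (Rlt_le _ _ hab)).

Definition itv_ball (x : itv hab) (eps : R) (y : itv hab) : Prop :=
  Rabs (y - x) < eps.

Lemma itv_ball_center (x : itv hab) (eps : posreal) : itv_ball x eps x.
Proof.
unfold itv_ball; rewrite Rminus_diag, Rabs_R0; apply cond_pos.
Qed.

Lemma itv_ball_sym (x y : itv hab) (eps : R) :
  itv_ball x eps y -> itv_ball y eps x.
Proof. unfold itv_ball; now rewrite Rabs_minus_sym. Qed.

Lemma itv_ball_triangle (x y z : itv hab) (e1 e2 : R) :
  itv_ball x e1 y -> itv_ball y e2 z -> itv_ball x (e1 + e2) z.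
Proof.
unfold itv_ball; intros H1 H2.
replace (z - x) with ((y - x) + (z - y)) by ring.
eapply Rle_lt_trans; [apply Rabs_triang | lra].
Qed.

Definition itv_UniformSpace_mixin :=
  UniformSpace.Mixin (itv hab) itv_left itv_ball itv_ball_center itv_ball_sym
    itv_ball_triangle.

Canonical itv_UniformSpace :=
  UniformSpace.Pack (itv hab) itv_UniformSpace_mixin (itv hab).

Lemma clamp_bounds (t : R) : a <= Rmax a (Rmin b t) <= b.
Proof.
split; [apply Rmax_l | apply Rmax_lub; [lra | apply Rmin_l]].
Qed.

Definition clamp (t : R) : itv hab := Itv a b hab _ (clamp_bounds t).

Lemma clamp_pt (x : itv hab) : clamp x = x.
Proof.
apply pt_inj; simpl; destruct x as [x hx]; simpl.
rewrite Rmin_right by lra; apply Rmax_right; lra.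
Qed.

Lemma clamp_lip (s t : R) : Rabs (clamp s - clamp t) <= Rabs (s - t).
Proof.
simpl; unfold Rmin; destruct (Rle_dec b s), (Rle_dec b t);
  unfold Rmax, Rabs;
  repeat match goal with
  | |- context [Rle_dec ?x ?y] => destruct (Rle_dec x y)
  end;
  repeat match goal with
  | |- context [Rcase_abs ?x] => destruct (Rcase_abs x)
  end; lra.
Qed.

Lemma itv_max_attained (g : itv hab -> R) :
  (forall x, continuous g x) -> exists x, forall y, g y <= g x.
Proof.
intros Hg.
destruct (continuity_ab_maj (fun t => g (clamp t)) a b) as [M [HM _]].
- lra.
- intros c _; apply continuity_pt_filterlim, filterlim_locally; intros eps.
  destruct (proj1 (filterlim_locally _ _) (Hg (clamp c)) eps) as [d Hd].
  exists d; intros y Hy; apply Hd.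
  change (Rabs (clamp y - clamp c) < d).
  eapply Rle_lt_trans; [apply clamp_lip | exact Hy].
- exists (clamp M); intros y.
  rewrite <- (clamp_pt y); apply HM, pt_bounds.
Qed.

Global Instance itv_locally'_proper (x : itv hab) : ProperFilter' (locally' x).
Proof.
constructor; [| typeclasses eauto].
intros [d Hd]; pose proof (cond_pos d) as Hd0; pose proof (pt_bounds x) as Hx.
destruct (Rle_dec (x + Rmin (d / 2) ((b - a) / 2)) b) as [Hy | Hy].
- assert (Hm : 0 < Rmin (d / 2) ((b - a) / 2)) by (apply Rmin_pos; lra).
  assert (B : a <= x + Rmin (d / 2) ((b - a) / 2) <= b) by lra.
  apply (Hd (Itv a b hab _ B)).
  + change (Rabs (x + Rmin (d / 2) ((b - a) / 2) - x) < d).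
    pose proof (Rmin_l (d / 2) ((b - a) / 2)).
    apply Rabs_def1; lra.
  + intros E; apply (f_equal pt) in E; simpl in E; lra.
- assert (Hm : 0 < Rmin (d / 2) ((b - a) / 2)) by (apply Rmin_pos; lra).
  pose proof (Rmin_l (d / 2) ((b - a) / 2)).
  pose proof (Rmin_r (d / 2) ((b - a) / 2)).
  assert (B : a <= x - Rmin (d / 2) ((b - a) / 2) <= b) by lra.
  apply (Hd (Itv a b hab _ B)).
  + change (Rabs (x - Rmin (d / 2) ((b - a) / 2) - x) < d).
    apply Rabs_def1; lra.
  + intros E; apply (f_equal pt) in E; simpl in E; lra.
Qed.

End Interval.

Record C_itv {a b : R} (hab : a < b) {K : AbsRing} (V : NormedModule K) := C_Itv {
  fct :> itv hab -> V;
  fct_continuous : forall x, continuous fct x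
}.

Arguments C_Itv {a b hab K V} _ _.
Arguments fct {a b hab K V} _ _.
Arguments fct_continuous {a b hab K V} _ _.

Lemma norm_minus_sym {K : AbsRing} {V : NormedModule K} (x y : V) :
  norm (minus x y) = norm (minus y x).
Proof. now rewrite <- norm_opp, opp_minus. Qed.

Lemma norm_minus_triangle {K : AbsRing} {V : NormedModule K} (x r y : V) :
  norm (minus x y) <= norm (minus x r) + norm (minus r y).
Proof. rewrite (minus_trans r); apply norm_triangle. Qed.

Section ContinuousFunctions.
Context {a b : R} (hab : a < b) {K : AbsRing} (V : NormedModule K).
Notation CV := (C_itv hab V).

Lemma C_itv_ext (f g : CV) : (forall x, f x = g x) -> f = g.
Proof.
destruct f as [f hf], g as [g hg]; simpl; intros E.
apply functional_extensionality in E; subst g.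
now rewrite (proof_irrelevance _ hf hg).
Qed.

Definition C_zero : CV :=
  C_Itv (fun _ => zero) (fun x => continuous_const (zero : V) x).

Definition C_plus (f g : CV) : CV :=
  C_Itv (fun x => plus (f x) (g x))
    (fun x => continuous_plus f g x (fct_continuous f x) (fct_continuous g x)).

Definition C_opp (f : CV) : CV :=
  C_Itv (fun x => opp (f x))
    (fun x => continuous_opp f x (fct_continuous f x)).

Definition C_scal (c : K) (f : CV) : CV :=
  C_Itv (fun x => scal c (f x))
    (fun x => continuous_scal_r c f x (fct_continuous f x)).

Lemma C_plus_comm (f g : CV) : C_plus f g = C_plus g f.
Proof. apply C_itv_ext; intros x; apply plus_comm. Qed.

Lemma C_plus_assoc (f g h : CV) :
  C_plus f (C_plus g h) = C_plus (C_plus f g) h.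
Proof. apply C_itv_ext; intros x; apply plus_assoc. Qed.

Lemma C_plus_zero_r (f : CV) : C_plus f C_zero = f.
Proof. apply C_itv_ext; intros x; apply plus_zero_r. Qed.

Lemma C_plus_opp_r (f : CV) : C_plus f (C_opp f) = C_zero.
Proof. apply C_itv_ext; intros x; apply (plus_opp_r (f x)). Qed.

Definition C_AbelianMonoid_mixin :=
  AbelianMonoid.Mixin CV C_plus C_zero C_plus_comm C_plus_assoc C_plus_zero_r.

Canonical C_AbelianMonoid := AbelianMonoid.Pack CV C_AbelianMonoid_mixin CV.

Definition C_AbelianGroup_mixin :=
  AbelianGroup.Mixin C_AbelianMonoid C_opp C_plus_opp_r.

Canonical C_AbelianGroup :=
  AbelianGroup.Pack CV (AbelianGroup.Class _ _ C_AbelianGroup_mixin) CV.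

Lemma C_scal_assoc (x y : K) (f : CV) :
  C_scal x (C_scal y f) = C_scal (mult x y) f.
Proof. apply C_itv_ext; intros t; apply (scal_assoc x y (f t)). Qed.

Lemma C_scal_one (f : CV) : C_scal one f = f.
Proof. apply C_itv_ext; intros t; apply (scal_one (f t)). Qed.

Lemma C_scal_distr_l (x : K) (f g : CV) :
  C_scal x (C_plus f g) = C_plus (C_scal x f) (C_scal x g).
Proof. apply C_itv_ext; intros t; apply (scal_distr_l x (f t) (g t)). Qed.

Lemma C_scal_distr_r (x y : K) (f : CV) :
  C_scal (plus x y) f = C_plus (C_scal x f) (C_scal y f).
Proof. apply C_itv_ext; intros t; apply (scal_distr_r x y (f t)). Qed.

Definition C_ModuleSpace_mixin :=
  ModuleSpace.Mixin K C_AbelianGroup C_scal C_scal_assoc C_scal_one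
    C_scal_distr_l C_scal_distr_r.

Canonical C_ModuleSpace :=
  ModuleSpace.Pack K CV (ModuleSpace.Class _ _ _ C_ModuleSpace_mixin) CV.

Definition sup_norm (f : CV) : R :=
  real (Lub_Rbar (fun r => exists x : itv hab, r = norm (f x))).

Lemma sup_norm_max (f : CV) :
  exists x : itv hab,
    sup_norm f = norm (f x) /\ forall y : itv hab, norm (f y) <= norm (f x).
Proof.
destruct (itv_max_attained hab (fun x => norm (f x))) as [x Hx].
{ intros x.
  apply (filterlim_comp _ _ _ f norm _ _ _ (fct_continuous f x)
           (filterlim_norm (f x))). }
exists x; split; [| exact Hx].
unfold sup_norm.
rewrite (is_lub_Rbar_unique _ (Finite (norm (f x)))); [reflexivity |].
split.
- intros r [y ->]; apply Hx.
- intros l Hl; apply Hl; now exists x.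
Qed.

Lemma sup_norm_ub (f : CV) (y : itv hab) : norm (f y) <= sup_norm f.
Proof. destruct (sup_norm_max f) as [x [-> Hx]]; apply Hx. Qed.

Lemma sup_norm_le (f : CV) (M : R) :
  (forall x, norm (f x) <= M) -> sup_norm f <= M.
Proof. intros H; destruct (sup_norm_max f) as [x [-> _]]; apply H. Qed.

Lemma sup_norm_triangle (f g : CV) :
  sup_norm (plus f g) <= sup_norm f + sup_norm g.
Proof.
apply sup_norm_le; intros x.
eapply Rle_trans; [apply (norm_triangle (f x) (g x)) |].
apply Rplus_le_compat; apply sup_norm_ub.
Qed.

Lemma sup_norm_scal (c : K) (f : CV) :
  sup_norm (scal c f) <= abs c * sup_norm f.
Proof.
apply sup_norm_le; intros x.
eapply Rle_trans; [apply (norm_scal c (f x)) |].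
apply Rmult_le_compat_l; [apply abs_ge_0 | apply sup_norm_ub].
Qed.

Lemma sup_norm_eq_0 (f : CV) : sup_norm f = 0 -> f = zero.
Proof.
intros H; apply C_itv_ext; intros x; apply (norm_eq_zero (f x)).
apply Rle_antisym; [rewrite <- H; apply sup_norm_ub | apply norm_ge_0].
Qed.

Definition C_ball (f : CV) (eps : R) (g : CV) : Prop :=
  sup_norm (minus g f) < eps.

Lemma C_ball_center (f : CV) (eps : posreal) : C_ball f eps f.
Proof.
unfold C_ball; eapply Rle_lt_trans; [| apply (cond_pos eps)].
apply sup_norm_le; intros x.
change (norm (minus (f x) (f x)) <= 0).
apply Req_le; transitivity (norm (zero : V));
  [f_equal; exact (minus_eq_zero (f x)) | exact (norm_zero (V := V))].
Qed.

Lemma C_ball_sym (f g : CV) (eps : R) : C_ball f eps g -> C_ball g eps f.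
Proof.
unfold C_ball; apply Rle_lt_trans, sup_norm_le; intros x.
change (norm (minus (f x) (g x)) <= sup_norm (minus g f)).
rewrite (norm_minus_sym (V := V) (f x) (g x)).
apply (sup_norm_ub (minus g f) x).
Qed.

Lemma C_ball_triangle (f g h : CV) (e1 e2 : R) :
  C_ball f e1 g -> C_ball g e2 h -> C_ball f (e1 + e2) h.
Proof.
unfold C_ball; intros H1 H2.
rewrite (minus_trans g h f).
eapply Rle_lt_trans; [apply sup_norm_triangle | lra].
Qed.

Definition C_itv_UniformSpace_mixin :=
  UniformSpace.Mixin CV C_zero C_ball C_ball_center C_ball_sym C_ball_triangle.

Canonical C_itv_UniformSpace :=
  UniformSpace.Pack CV C_itv_UniformSpace_mixin CV.

Canonical C_itv_NormedModuleAux :=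
  NormedModuleAux.Pack K CV
    (NormedModuleAux.Class _ _ (ModuleSpace.class _ C_ModuleSpace)
       C_itv_UniformSpace_mixin) CV.

Lemma C_norm_compat2 (f g : CV) (eps : posreal) :
  ball f eps g -> sup_norm (minus g f) < 1 * eps.
Proof. now rewrite Rmult_1_l. Qed.

Definition C_itv_NormedModule_mixin :=
  NormedModule.Mixin K C_itv_NormedModuleAux sup_norm 1 sup_norm_triangle
    sup_norm_scal (fun _ _ _ h => h) C_norm_compat2 sup_norm_eq_0.

Canonical C_itv_NormedModule :=
  NormedModule.Pack K CV
    (NormedModule.Class _ _ _ C_itv_NormedModule_mixin) CV.

End ContinuousFunctions.

Section Completeness.
Context {a b : R} (hab : a < b) {K : AbsRing} (V : CompleteNormedModule K).
Notation VN := (CompleteNormedModule.NormedModule K V).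
Notation CV := (C_itv hab VN).

Lemma C_itv_complete (F : (CV -> Prop) -> Prop) :
  ProperFilter F -> cauchy F ->
  exists f : CV, forall eps : posreal, F (ball f eps).
Proof.
intros FF HF.
set (l := fun x : itv hab =>
  (lim (T := V) (filtermap (fun f : CV => (f x : V)) F) : VN)).
assert (Hl : forall x (d : posreal), F (fun f : CV => ball (l x) d (f x))).
{ intros x d.
  apply (complete_cauchy (T := V) (filtermap (fun f : CV => (f x : V)) F)).
  - apply filtermap_proper_filter, FF.
  - intros eps; destruct (HF eps) as [f0 Hf0]; exists (f0 x).
    unfold filtermap; revert Hf0; apply filter_imp; intros f Hf.
    apply (norm_compat1 (V := VN)).
    eapply Rle_lt_trans; [apply (sup_norm_ub _ _ (minus f f0) x) | exact Hf]. }
assert (Hu : forall (eps : posreal) (f0 : CV), F (ball f0 eps) ->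
   forall x, norm (minus (f0 x) (l x)) <= eps).
{ intros eps f0 Hf0 x; apply Rnot_lt_le; intros Hlt.
  pose proof (norm_factor_gt_0 (V := VN)) as Hk.
  set (k := norm_factor (V := VN)) in *.
  assert (Hd : 0 < (norm (minus (f0 x) (l x)) - eps) / k).
  { apply Rdiv_lt_0_compat; lra. }
  destruct (filter_ex _ (filter_and _ _ Hf0 (Hl x (mkposreal _ Hd))))
    as [f [H1 H2]].
  apply (norm_compat2 (V := VN)) in H2; simpl in H2; fold k in H2.
  replace (k * ((norm (minus (f0 x) (l x)) - eps) / k))
    with (norm (minus (f0 x) (l x)) - eps) in H2 by (field; lra).
  assert (H3 : norm (minus (f0 x) (f x)) < eps).
  { rewrite (norm_minus_sym (V := VN) (f0 x) (f x)).
    eapply Rle_lt_trans; [apply (sup_norm_ub _ _ (minus f f0) x) | exact H1]. }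
  pose proof (norm_minus_triangle (V := VN) (f0 x) (f x) (l x)) as H4.
  lra. }
assert (Hc : forall x, continuous l x).
{ intros x; apply (filterlim_locally_ball_norm (U := VN)); intros eps.
  assert (He : 0 < eps / 4) by (pose proof (cond_pos eps); lra).
  destruct (HF (mkposreal _ He)) as [f0 Hf0].
  pose proof (Hu _ _ Hf0) as H; simpl in H.
  generalize (proj1 (filterlim_locally_ball_norm (U := VN) f0 (f0 x))
           (fct_continuous f0 x) (mkposreal _ He)).
  apply filter_imp; intros y Hy; unfold ball_norm in *; simpl in Hy.
  pose proof (H y) as Hy1; pose proof (H x) as Hx1.
  rewrite (norm_minus_sym (V := VN) (f0 y) (l y)) in Hy1.
  pose proof (norm_minus_triangle (V := VN) (l y) (f0 y) (f0 x)) as T1.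
  pose proof (norm_minus_triangle (V := VN) (l y) (f0 x) (l x)) as T2.
  pose proof (cond_pos eps); lra. }
exists (C_Itv l Hc); intros eps.
assert (He : 0 < eps / 4) by (pose proof (cond_pos eps); lra).
destruct (HF (mkposreal _ He)) as [f0 Hf0].
pose proof (Hu _ _ Hf0) as H; simpl in H.
revert Hf0; apply filter_imp; intros f Hf.
change (sup_norm hab VN (minus f f0) < eps / 4) in Hf.
change (sup_norm hab VN (minus f (C_Itv l Hc)) < eps).
apply Rle_lt_trans with (eps / 4 + eps / 4);
  [| pose proof (cond_pos eps); lra].
apply sup_norm_le; intros x.
change (norm (minus (f x) (l x)) <= eps / 4 + eps / 4).
eapply Rle_trans; [apply (norm_minus_triangle (V := VN) _ (f0 x)) |].
apply Rplus_le_compat; [| apply H].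
apply Rle_trans with (2 := Rlt_le _ _ Hf), (sup_norm_ub _ _ (minus f f0) x).
Qed.

Definition C_lim (F : (CV -> Prop) -> Prop) : CV :=
  epsilon (inhabits (C_zero hab VN)) (fun f => forall eps : posreal, F (ball f eps)).

Lemma C_lim_cauchy (F : (CV -> Prop) -> Prop) :
  ProperFilter F -> cauchy F ->
  forall eps : posreal, F (ball (C_lim F) eps).
Proof.
intros FF HF; unfold C_lim; apply epsilon_spec, (C_itv_complete F FF HF).
Qed.

Lemma C_lim_close (F1 F2 : (CV -> Prop) -> Prop) :
  filter_le F1 F2 -> filter_le F2 F1 -> close (C_lim F1) (C_lim F2).
Proof.
intros H1 H2; replace F2 with F1; [apply close_refl |].
apply functional_extensionality; intros P; apply propositional_extensionality.
split; [apply H2 | apply H1].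
Qed.

Definition C_itv_CompleteSpace_mixin :=
  CompleteSpace.Mixin (C_itv_UniformSpace hab VN) C_lim C_lim_cauchy C_lim_close.

Canonical C_itv_CompleteSpace :=
  CompleteSpace.Pack CV
    (CompleteSpace.Class _ _ C_itv_CompleteSpace_mixin) CV.

Canonical C_itv_CompleteNormedModule :=
  CompleteNormedModule.Pack K CV
    (CompleteNormedModule.Class _ _ (NormedModule.class _ (C_itv_NormedModule hab VN))
       C_itv_CompleteSpace_mixin) CV.

End Completeness.

Inductive scalar_field := Real | Complex.

Definition scalar (F : scalar_field) : AbsRing :=
  match F with Real => R_AbsRing | Complex => C_AbsRing end.

Definition scalar_space (F : scalar_field) : CompleteNormedModule (scalar F) :=
  match F with
  | Real => R_CompleteNormedModule
  | Complex => C_CompleteNormedModule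
  end.

Definition of_real (F : scalar_field) : R -> scalar F :=
  match F with Real => fun t => t | Complex => RtoC end.

Lemma scalar_mult_comm (F : scalar_field) (x y : scalar F) :
  mult x y = mult y x.
Proof. destruct F; [apply Rmult_comm | apply Cmult_comm]. Qed.

Lemma minus_plus_plus {G : AbelianGroup} (x1 x2 y1 y2 : G) :
  minus (plus x1 x2) (plus y1 y2) = plus (minus x1 y1) (minus x2 y2).
Proof.
unfold minus; rewrite opp_plus, <- 2!plus_assoc; f_equal.
now rewrite 2!plus_assoc, (plus_comm x2).
Qed.

Lemma scal_minus_plus {K : AbsRing} {V : NormedModule K} (c : K)
  (x1 x2 y1 y2 : V) :
  scal c (minus (plus x1 x2) (plus y1 y2)) =
  plus (scal c (minus x1 y1)) (scal c (minus x2 y2)).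
Proof.
rewrite <- scal_distr_l; f_equal; apply (minus_plus_plus (G := V)).
Qed.

Lemma scal_minus_scal {K : AbsRing} {V : NormedModule K} (c d : K) (x y : V) :
  mult c d = mult d c ->
  scal c (minus (scal d x) (scal d y)) = scal d (scal c (minus x y)).
Proof.
intros E; rewrite (scal_assoc d c), <- E, <- scal_assoc; f_equal.
symmetry; etransitivity; [apply (scal_distr_l (V := V)) |].
unfold minus; f_equal; apply (scal_opp_r (V := V)).
Qed.

Section Derivatives.
Context (F : scalar_field) {a b : R} (hab : a < b).
Notation V := (CompleteNormedModule.NormedModule _ (scalar_space F)).

(** [g] is the derivative of [f] on [a, b].  The variable [y] of the difference
    quotient stays in [a, b], so the derivative is one-sided at [a] and [b]. *)
Definition is_derivative (f g : itv hab -> V) : Prop :=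
  forall x : itv hab,
    filterlim (fun y : itv hab =>
        scal (of_real F (/ (pt y - pt x))) (minus (f y) (f x)))
      (locally' x) (locally (g x)).

Fixpoint is_nth_derivative (n : nat) (f g : itv hab -> V) : Prop :=
  match n with
  | O => f = g
  | S n => exists h, is_nth_derivative n f h /\ is_derivative h g
  end.

Definition is_Cn (n : nat) (f : itv hab -> V) : Prop :=
  forall k : nat, (k <= n)%nat ->
    exists g, is_nth_derivative k f g /\ forall x, continuous g x.

Lemma is_derivative_unique (f g h : itv hab -> V) :
  is_derivative f g -> is_derivative f h -> g = h.
Proof.
intros Hg Hh; apply functional_extensionality; intros x.
exact (filterlim_locally_unique (V := V) _ _ _ (Hg x) (Hh x)).
Qed.

Lemma is_nth_derivative_unique (n : nat) (f g h : itv hab -> V) :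
  is_nth_derivative n f g -> is_nth_derivative n f h -> g = h.
Proof.
revert g h; induction n as [| n IH]; simpl; intros g h.
- congruence.
- intros [u [Hu Hg]] [v [Hv Hh]].
  rewrite (IH _ _ Hv Hu) in Hh; exact (is_derivative_unique _ _ _ Hg Hh).
Qed.

Lemma is_derivative_zero : is_derivative (fun _ => zero) (fun _ => zero).
Proof.
intros x; eapply filterlim_ext; [| apply filterlim_const].
intros y; simpl; rewrite minus_eq_zero.
symmetry; apply (scal_zero_r (V := V)).
Qed.

Lemma is_derivative_plus (f1 f2 g1 g2 : itv hab -> V) :
  is_derivative f1 g1 -> is_derivative f2 g2 ->
  is_derivative (fun x => plus (f1 x) (f2 x)) (fun x => plus (g1 x) (g2 x)).
Proof.
intros H1 H2 x.
eapply filterlim_ext;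
  [| exact (filterlim_comp_2 _ _ plus (H1 x) (H2 x)
              (filterlim_plus (V := V) (g1 x) (g2 x)))].
intros y; simpl.
symmetry; apply (scal_minus_plus (V := V)).
Qed.

Lemma is_derivative_scal (c : scalar F) (f g : itv hab -> V) :
  is_derivative f g ->
  is_derivative (fun x => scal c (f x)) (fun x => scal c (g x)).
Proof.
intros H x.
eapply filterlim_ext;
  [| exact (filterlim_comp _ _ _ _ (scal c) _ _ _ (H x)
              (filterlim_scal_r (V := V) c (g x)))].
intros y; simpl.
symmetry; apply (scal_minus_scal (V := V)), scalar_mult_comm.
Qed.

Lemma is_nth_derivative_zero (n : nat) :
  is_nth_derivative n (fun _ => zero) (fun _ => zero).
Proof.
induction n as [| n IH]; [reflexivity |].
exists (fun _ => zero); split; [exact IH | exact is_derivative_zero].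
Qed.

Lemma is_nth_derivative_plus (n : nat) (f1 f2 g1 g2 : itv hab -> V) :
  is_nth_derivative n f1 g1 -> is_nth_derivative n f2 g2 ->
  is_nth_derivative n (fun x => plus (f1 x) (f2 x))
    (fun x => plus (g1 x) (g2 x)).
Proof.
revert g1 g2; induction n as [| n IH]; simpl; intros g1 g2.
- now intros -> ->.
- intros [h1 [H1 D1]] [h2 [H2 D2]].
  exists (fun x => plus (h1 x) (h2 x)); split;
    [now apply IH | now apply is_derivative_plus].
Qed.

Lemma is_nth_derivative_scal (n : nat) (c : scalar F) (f g : itv hab -> V) :
  is_nth_derivative n f g ->
  is_nth_derivative n (fun x => scal c (f x)) (fun x => scal c (g x)).
Proof.
revert g; induction n as [| n IH]; simpl; intros g.
- now intros ->.
- intros [h [H D]].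
  exists (fun x => scal c (h x)); split;
    [now apply IH | now apply is_derivative_scal].
Qed.

Definition derivative_graph (n : nat) (f g : C_itv hab V) : Prop :=
  is_Cn n f /\ is_nth_derivative n f g.

Lemma derivative_graph_functional (n : nat) (f g h : C_itv hab V) :
  derivative_graph n f g -> derivative_graph n f h -> g = h.
Proof.
intros [_ Hg] [_ Hh]; apply C_itv_ext; intros x.
now rewrite (is_nth_derivative_unique n f g h Hg Hh).
Qed.

Lemma derivative_graph_zero (n : nat) :
  derivative_graph n (C_zero hab V) (C_zero hab V).
Proof.
split; [| apply is_nth_derivative_zero].
intros k _; exists (fun _ => zero); split;
  [apply is_nth_derivative_zero | intros x; apply continuous_const].
Qed.

Lemma derivative_graph_plus (n : nat) (f1 f2 g1 g2 : C_itv hab V) :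
  derivative_graph n f1 g1 -> derivative_graph n f2 g2 ->
  derivative_graph n (C_plus hab V f1 f2) (C_plus hab V g1 g2).
Proof.
intros [C1 D1] [C2 D2]; split; [| now apply is_nth_derivative_plus].
intros k Hk; destruct (C1 k Hk) as [u [Hu Cu]], (C2 k Hk) as [v [Hv Cv]].
exists (fun x => plus (u x) (v x)); split;
  [now apply is_nth_derivative_plus |].
intros x; exact (continuous_plus u v x (Cu x) (Cv x)).
Qed.

Lemma derivative_graph_scal (n : nat) (c : scalar F) (f g : C_itv hab V) :
  derivative_graph n f g ->
  derivative_graph n (C_scal hab V c f) (C_scal hab V c g).
Proof.
intros [C D]; split; [| now apply is_nth_derivative_scal].
intros k Hk; destruct (C k Hk) as [u [Hu Cu]].
exists (fun x => scal c (u x)); split; [now apply is_nth_derivative_scal |].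
intros x; exact (continuous_scal_r c u x (Cu x)).
Qed.

Definition derivative_operator (n : nat) :
    linear_operator (C_itv_NormedModule hab V) :=
  LinearOperator (scalar F) (C_itv_NormedModule hab V) (derivative_graph n)
    (derivative_graph_functional n) (derivative_graph_zero n)
    (derivative_graph_plus n) (derivative_graph_scal n).

Lemma derivative_operator_domain (n : nat) (f : C_itv hab V) :
  domain (derivative_operator n) f <-> is_Cn n f.
Proof.
split; [intros [g [H _]]; exact H |].
intros H; destruct (H n (le_n n)) as [g [Hg Cg]].
now exists (C_Itv g Cg).
Qed.

End Derivatives.

(* Main.v *)
(** In terms of Taylor coefficients at [a], [f = sum_i c_i (x - a)^i / i!], with
    [|c_i| <= M 2^i], the derivative is the backward shift of [c], and sequences
    that agree up to a large index give uniformly close functions.  By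
    Weierstrass's theorem finite sequences give a dense set of functions.
    Repeating a finite sequence with a large period, a multiple of [n], gives a
    periodic point nearby.  A sequence that contains each finite sequence over a
    countable dense set of scalars, at arbitrarily large positions divisible by
    [n] and followed by long runs of zeros, gives a hypercyclic vector. *)

Require Import Defs.
From Stdlib Require Import Reals Factorial Lra Lia List FunctionalExtensionality.
From Coquelicot Require Import Coquelicot.
From mathcomp Require choice.
Open Scope R_scope.

(** * Series in normed modules, the exponential tail, and elementary inequalities *)

Lemma is_series_norm_le {K : AbsRing} {V : NormedModule K} (u : nat -> V)
    (w : nat -> R) (l : V) (s : R) :
  (forall i, norm (u i) <= w i) -> is_series u l -> is_series w s -> norm l <= s.
Proof.
intros Hle Hu Hw.
apply (is_lim_seq_le (fun m => norm (sum_n u m)) (fun m => sum_n w m)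
         (norm l) s).
- intros m; eapply Rle_trans; [apply (norm_sum_n_m u) |].
  apply (sum_n_m_le _ w); exact Hle.
- exact (filterlim_comp _ _ _ _ _ _ _ _ Hu (filterlim_norm l)).
- exact Hw.
Qed.

Lemma is_series_unique_norm {K : AbsRing} {V : NormedModule K} (u : nat -> V)
    (l1 l2 : V) :
  is_series u l1 -> is_series u l2 -> l1 = l2.
Proof. exact (filterlim_locally_unique _ l1 l2). Qed.

Lemma is_series_finite {K : AbsRing} {V : NormedModule K} (u : nat -> V)
    (m : nat) :
  (forall i, (m < i)%nat -> u i = zero) -> is_series u (sum_n u m).
Proof.
intros Hu; apply filterlim_locally; intros eps; exists m; intros k Hk.
replace (sum_n u k) with (sum_n u m); [apply ball_center |].
induction Hk as [| k Hk IH]; [reflexivity |].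
rewrite sum_Sn, Hu, plus_zero_r by lia; exact IH.
Qed.

Lemma is_series_exp (x : R) :
  is_series (fun i => x ^ i / INR (fact i)) (exp x).
Proof.
eapply is_series_ext; [| exact (is_exp_Reals x)].
intros i; rewrite pow_n_pow; reflexivity.
Qed.

(** The tail is presented as a series of its own so that it can dominate, term by term, a function
    series whose first [S m] terms vanish. *)
Lemma exp_tail_small (x eps : R) : 0 < eps ->
  exists m s, is_series (fun k => x ^ (S m + k) / INR (fact (S m + k))) s
    /\ s < eps.
Proof.
intros He.
destruct (proj1 (filterlim_locally _ _) (is_series_exp x) (mkposreal _ He))
  as [m Hm].
specialize (Hm m (le_n m)).
change (Rabs (sum_n (fun i => x ^ i / INR (fact i)) m - exp x) < eps) in Hm.
exists m, (exp x - sum_n (fun i => x ^ i / INR (fact i)) m); split.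
- apply (is_series_incr_n (fun i => x ^ i / INR (fact i))); [lia |].
  change (is_series (fun i => x ^ i / INR (fact i))
   (exp x - sum_n (fun i => x ^ i / INR (fact i)) m
     + sum_n (fun i => x ^ i / INR (fact i)) m)).
  replace (exp x - _ + _) with (exp x) by ring; apply is_series_exp.
- apply Rabs_def2 in Hm; lra.
Qed.

(** Divided by [(i + 1)!], the bound becomes [(y - x)^2 i r^i / i!], which is summable over [i];
    this allows a Taylor estimate of a power series term by term. *)
Lemma monomial_taylor (r x y : R) (i : nat) : 1 <= r -> Rabs x <= r ->
  Rabs y <= r ->
  Rabs (y ^ S i - x ^ S i - INR (S i) * (y - x) * x ^ i)
    <= INR (S i) * INR i * (y - x) ^ 2 * r ^ i.
Proof.
intros Hr Hx Hy; induction i as [| i IH].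
- simpl; rewrite Rabs_right; lra.
(* The next remainder is [y] times the current one plus [(i + 1) (y - x)^2 x^i]. Since [1 <= r], the
   power [x^i] is at most [r^(i + 1)] in absolute value, the power of [r] that the goal has. *)
- replace (y ^ S (S i) - x ^ S (S i) - INR (S (S i)) * (y - x) * x ^ S i)
    with (y * (y ^ S i - x ^ S i - INR (S i) * (y - x) * x ^ i)
          + INR (S i) * (y - x) ^ 2 * x ^ i)
    by (rewrite !S_INR; simpl; ring).
  eapply Rle_trans; [apply Rabs_triang |].
  rewrite !Rabs_mult, (Rabs_right (INR (S i))), (Rabs_right ((y - x) ^ 2))
    by (try apply Rle_ge, pow2_ge_0; apply Rle_ge, pos_INR).
  assert (Hp : 0 <= r ^ i) by (apply pow_le; lra).
  assert (Hxi : Rabs (x ^ i) <= r * r ^ i).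
  { apply Rle_trans with (r ^ i); [| nra].
    rewrite <- RPow_abs; apply pow_incr; split; [apply Rabs_pos | exact Hx]. }
  pose proof (pow2_ge_0 (y - x)) as Hd; pose proof (pos_INR i) as Hi.
  set (d := (y - x) ^ 2) in *; rewrite (S_INR (S i)), S_INR in *.
  apply Rle_trans with (r * ((INR i + 1) * INR i * d * r ^ i)
                        + (INR i + 1) * d * (r * r ^ i)).
  + apply Rplus_le_compat.
    * apply Rmult_le_compat; try apply Rabs_pos; assumption.
    * apply Rmult_le_compat_l; [nra | exact Hxi].
  + simpl.
    assert (0 <= (INR i + 1) * (d * (r * r ^ i))).
    { apply Rmult_le_pos; [lra |]; apply Rmult_le_pos; nra. }
    nra.
Qed.

Lemma minus_plus_cancel {G : AbelianGroup} (x y : G) : plus (minus x y) y = x.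
Proof.
unfold minus; now rewrite <- plus_assoc, plus_opp_l, plus_zero_r.
Qed.

Lemma minus_minus_cancel {G : AbelianGroup} (x y z : G) :
  minus (minus x z) (minus y z) = minus x y.
Proof.
now rewrite (minus_trans z x y); unfold minus at 1; rewrite opp_minus.
Qed.

Lemma INR_S_le_pow2 (i : nat) : INR (S i) <= 2 ^ i.
Proof.
induction i as [| i IH]; [simpl; lra |].
rewrite S_INR; simpl pow; pose proof (pow_R1_Rle 2 i); lra.
Qed.

Lemma INR_le_pow2 (i : nat) : INR i <= 2 ^ i.
Proof. pose proof (INR_S_le_pow2 i) as H; rewrite S_INR in H; lra. Qed.

(** This bounds a linearly growing sequence after a shift by at most [i], with a constant that does
    not depend on the shift. *)
Lemma INR_double_le_pow2 (i : nat) : (1 <= i)%nat -> INR (2 * i) <= 2 ^ i.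
Proof.
intros Hi; destruct i as [| i]; [lia |].
rewrite mult_INR; simpl pow; change (INR 2) with 2.
apply Rmult_le_compat_l; [lra | apply INR_S_le_pow2].
Qed.

Lemma op_pow_zero {K : AbsRing} {X : NormedModule K} (A : linear_operator X)
    (m : nat) (g : X) :
  op_pow A m zero g -> g = zero.
Proof.
revert g; induction m as [| m IH]; simpl; intros g; [congruence |].
intros [h [Hh Hg]]; rewrite (IH h Hh) in Hg.
exact (graph_functional _ A _ _ _ Hg (graph_zero _ A)).
Qed.

(** * Multiplication by real numbers, uniformly in the scalar field *)

Section Scale.
Context (F : scalar_field).
Notation V := (CompleteNormedModule.NormedModule _ (scalar_space F)).

Definition scale (r : R) (v : V) : V := scal (of_real F r) v.

Lemma of_real_plus (r s : R) : of_real F (r + s) = plus (of_real F r) (of_real F s).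
Proof. destruct F; [reflexivity | apply RtoC_plus]. Qed.

Lemma of_real_mult (r s : R) : of_real F (r * s) = mult (of_real F r) (of_real F s).
Proof. destruct F; [reflexivity | apply RtoC_mult]. Qed.

Lemma of_real_one : of_real F 1 = one.
Proof. now destruct F. Qed.

Lemma abs_of_real (r : R) : abs (of_real F r) = Rabs r.
Proof. destruct F; [reflexivity | apply Cmod_R]. Qed.

Lemma scale_plus_l (r s : R) (v : V) : scale (r + s) v = plus (scale r v) (scale s v).
Proof. unfold scale; rewrite of_real_plus; apply (scal_distr_r (V := V)). Qed.

Lemma scale_plus_r (r : R) (v w : V) :
  scale r (plus v w) = plus (scale r v) (scale r w).
Proof. apply (scal_distr_l (V := V)). Qed.

Lemma scale_scale (r s : R) (v : V) : scale r (scale s v) = scale (r * s) v.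
Proof. unfold scale; rewrite of_real_mult; apply (scal_assoc (V := V)). Qed.

Lemma scale_one (v : V) : scale 1 v = v.
Proof. unfold scale; rewrite of_real_one; apply (scal_one (V := V)). Qed.

Lemma scale_zero_r (r : R) : scale r zero = zero.
Proof. apply (scal_zero_r (V := V)). Qed.

Lemma scale_opp_r (r : R) (v : V) : scale r (opp v) = opp (scale r v).
Proof. apply (scal_opp_r (V := V)). Qed.

Lemma scale_zero_l (v : V) : scale 0 v = zero.
Proof.
apply (plus_reg_l (scale 0 v)).
rewrite <- scale_plus_l, Rplus_0_r; symmetry; apply plus_zero_r.
Qed.

Lemma scale_opp_l (r : R) (v : V) : scale (- r) v = opp (scale r v).
Proof.
apply (plus_reg_l (scale r v)).
rewrite <- scale_plus_l, Rplus_opp_r, scale_zero_l; symmetry.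
apply (plus_opp_r (G := V)).
Qed.

Lemma scale_minus_l (r s : R) (v : V) :
  scale (r - s) v = minus (scale r v) (scale s v).
Proof. unfold Rminus; rewrite scale_plus_l, scale_opp_l; reflexivity. Qed.

Lemma scale_minus_r (r : R) (v w : V) :
  scale r (minus v w) = minus (scale r v) (scale r w).
Proof.
transitivity (plus (scale r v) (scale r (opp w))); [apply scale_plus_r |].
rewrite scale_opp_r; reflexivity.
Qed.

Lemma norm_scale_le (r : R) (v : V) : norm (scale r v) <= Rabs r * norm v.
Proof. rewrite <- abs_of_real; apply (norm_scal (V := V)). Qed.

Lemma is_series_scale (r : R) (u : nat -> V) (l : V) :
  is_series u l -> is_series (fun i => scale r (u i)) (scale r l).
Proof. apply (is_series_scal (V := V)). Qed.

Lemma is_series_sub (u w : nat -> V) (l1 l2 : V) :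
  is_series u l1 -> is_series w l2 ->
  is_series (fun i => minus (u i) (w i)) (minus l1 l2).
Proof. apply (is_series_minus (V := V)). Qed.

End Scale.

(** * Functions given by their Taylor coefficients at [a] *)

Section Interval.
Context (F : scalar_field) {a b : R} (hab : a < b).
Notation V := (CompleteNormedModule.NormedModule _ (scalar_space F)).

Definition represents (c : nat -> V) (f : itv hab -> V) : Prop :=
  forall x : itv hab,
    is_series (fun i => scale F ((x - a) ^ i / INR (fact i)) (c i)) (f x).

(** Geometric growth makes the series converge on the whole interval, by comparison with the
    exponential series at [2 (b - a)]. The class is stable under shifts, at the price of a larger
    [M], and base 2 leaves room for linear growth. *)
Definition exp_bounded (M : R) (c : nat -> V) : Prop :=
  forall i, norm (c i) <= M * 2 ^ i.

Definition shift (k : nat) (c : nat -> V) : nat -> V := fun i => c (i + k)%nat.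

Lemma itv_offset (x : itv hab) : 0 <= x - a <= b - a.
Proof. pose proof (pt_bounds x); lra. Qed.

Lemma exp_bounded_ge_0 (M : R) (c : nat -> V) : exp_bounded M c -> 0 <= M.
Proof.
intros H; specialize (H 0%nat); pose proof (norm_ge_0 (c 0%nat)); simpl in H; lra.
Qed.

Lemma exp_bounded_shift (M : R) (c : nat -> V) (k : nat) :
  exp_bounded M c -> exp_bounded (M * 2 ^ k) (shift k c).
Proof.
intros H i; unfold shift; eapply Rle_trans; [apply H |].
rewrite pow_add; apply Req_le; ring.
Qed.

Lemma norm_term_le (M : R) (c : nat -> V) (x : itv hab) (i : nat) :
  exp_bounded M c ->
  norm (scale F ((x - a) ^ i / INR (fact i)) (c i))
    <= M * ((2 * (b - a)) ^ i / INR (fact i)).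
Proof.
intros H; pose proof (exp_bounded_ge_0 _ _ H) as HM.
pose proof (itv_offset x) as Hx; pose proof (INR_fact_lt_0 i) as Hf.
eapply Rle_trans; [apply norm_scale_le |].
assert (Hp : 0 <= (x - a) ^ i / INR (fact i)).
{ apply Rdiv_le_0_compat; [apply pow_le; lra | exact Hf]. }
rewrite Rabs_right by lra.
apply Rle_trans with ((b - a) ^ i / INR (fact i) * (M * 2 ^ i)).
- apply Rmult_le_compat; [exact Hp | apply norm_ge_0 | | apply H].
  apply Rmult_le_compat_r; [left; apply Rinv_0_lt_compat, Hf |].
  apply pow_incr; lra.
- rewrite Rpow_mult_distr; apply Req_le; field; lra.
Qed.

Lemma represents_ex (M : R) (c : nat -> V) :
  exp_bounded M c -> exists f, represents c f.
Proof.
intros H.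
assert (E : forall x : itv hab, exists l : V,
   is_series (fun i => scale F ((x - a) ^ i / INR (fact i)) (c i)) l).
{ intros x; apply (ex_series_le (V := scalar_space F) _
    (fun i => M * ((2 * (b - a)) ^ i / INR (fact i)))).
  - intros i; apply norm_term_le, H.
  - eexists; apply (is_series_scal (V := R_NormedModule) M), is_series_exp. }
exists (fun x => proj1_sig
  (ClassicalEpsilon.constructive_indefinite_description _ (E x))).
intros x; exact (proj2_sig
  (ClassicalEpsilon.constructive_indefinite_description _ (E x))).
Qed.

Lemma represents_unique (c : nat -> V) (f g : itv hab -> V) :
  represents c f -> represents c g -> f = g.
Proof.
intros Hf Hg; apply functional_extensionality; intros x.
exact (is_series_unique_norm _ _ _ (Hf x) (Hg x)).
Qed.

Lemma represents_plus (c d : nat -> V) (f g : itv hab -> V) :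
  represents c f -> represents d g ->
  represents (fun i => plus (c i) (d i)) (fun x => plus (f x) (g x)).
Proof.
intros Hf Hg x; eapply is_series_ext;
  [| exact (is_series_plus _ _ _ _ (Hf x) (Hg x))].
intros i; symmetry; apply scale_plus_r.
Qed.

Lemma represents_scale (r : R) (c : nat -> V) (f : itv hab -> V) :
  represents c f ->
  represents (fun i => scale F r (c i)) (fun x => scale F r (f x)).
Proof.
intros Hf x; eapply is_series_ext; [| exact (is_series_scale F r _ _ (Hf x))].
intros i; simpl; rewrite !scale_scale; f_equal; apply Rmult_comm.
Qed.

Lemma represents_minus (c d : nat -> V) (f g : itv hab -> V) :
  represents c f -> represents d g ->
  represents (fun i => minus (c i) (d i)) (fun x => minus (f x) (g x)).
Proof.
intros Hf Hg x; eapply is_series_ext;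
  [| exact (is_series_sub F _ _ _ _ (Hf x) (Hg x))].
intros i; symmetry; apply scale_minus_r.
Qed.

Lemma represents_shift1 (c : nat -> V) (f : itv hab -> V) (x : itv hab) :
  represents c f ->
  is_series (fun i => scale F ((x - a) ^ S i / INR (fact (S i))) (shift 1 c i))
    (minus (f x) (c 0%nat)).
Proof.
intros Hf.
assert (H : is_series
    (fun i => scale F ((x - a) ^ S i / INR (fact (S i))) (c (S i)))
    (minus (f x) (c 0%nat))).
{ apply (is_series_incr_1 (V := V)
    (fun i => scale F ((x - a) ^ i / INR (fact i)) (c i))).
  replace (plus _ _) with (f x); [apply Hf |].
  simpl; rewrite Rdiv_1_r, scale_one; symmetry.
  apply (minus_plus_cancel (G := V)). }
eapply is_series_ext; [| exact H].
intros i; unfold shift; rewrite Nat.add_1_r; reflexivity.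
Qed.

Lemma represents_norm_le (M : R) (c : nat -> V) (f : itv hab -> V)
    (x : itv hab) :
  exp_bounded M c -> represents c f -> norm (f x) <= M * exp (2 * (b - a)).
Proof.
intros H Hf.
apply (is_series_norm_le _ _ _ _ (fun i => norm_term_le M c x i H) (Hf x)).
apply (is_series_scal (V := R_NormedModule) M), is_series_exp.
Qed.

(** The index [m] depends only on [M] and [eps]: the tail of every such series is dominated by [M]
    times the same exponential tail. *)
Lemma represents_tail (M eps : R) : 0 < eps ->
  exists m, forall (c : nat -> V) (f : itv hab -> V),
    exp_bounded M c -> (forall i, (i <= m)%nat -> c i = zero) ->
    represents c f -> forall x, norm (f x) < eps.
Proof.
intros He.
(* No sequence is given yet, so [0 <= M] is not known; [Rabs M + 1] is a positive denominator in any
   case. *)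
destruct (exp_tail_small (2 * (b - a)) (eps / (Rabs M + 1))) as [m [s [Hs Hlt]]].
{ apply Rdiv_lt_0_compat; [exact He | pose proof (Rabs_pos M); lra]. }
exists m; intros c f Hc H0 Hf x.
pose proof (exp_bounded_ge_0 _ _ Hc) as HM; rewrite Rabs_right in Hlt by lra.
assert (Hs0 : 0 <= s).
{ apply Rle_trans with (norm (zero : R_NormedModule)); [apply norm_ge_0 |].
  refine (is_series_norm_le (V := R_NormedModule) (fun _ => zero) _ zero s _ _ Hs).
  - intros i; rewrite (norm_zero (V := R_NormedModule)); apply Rdiv_le_0_compat;
      [apply pow_le; lra | apply INR_fact_lt_0].
  - eapply filterlim_ext; [| apply filterlim_const].
    intros k; symmetry; apply (sum_n_m_const_zero (G := R_AbelianGroup)). }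
apply Rle_lt_trans with (M * s).
- refine (is_series_norm_le _ _ _ _ (fun i => norm_term_le M c x (S m + i) Hc)
    _ (is_series_scal (V := R_NormedModule) M _ _ Hs)).
  apply (is_series_incr_n (V := V)
    (fun i => scale F ((x - a) ^ i / INR (fact i)) (c i))); [lia |].
  replace (plus _ _) with (f x); [apply Hf |].
  rewrite (sum_n_ext_loc _ (fun _ => zero) m);
    [| intros i Hi; rewrite H0 by exact Hi; apply scale_zero_r].
  unfold sum_n; rewrite sum_n_m_const_zero, plus_zero_r; reflexivity.
- apply Rlt_div_r in Hlt; [nra | lra].
Qed.

(** Summing [monomial_taylor] over the series gives a quadratic remainder with a constant uniform in
    [x] and [y]. In [4 (b - a + 1)], one factor 2 is the growth rate of [c] and the other absorbs
    [i <= 2^i]; [b - a + 1] is the radius [r >= 1]. The factor 2 of [2 * M] comes from the shift by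
    one. *)
Lemma represents_taylor (M : R) (c : nat -> V) (f g : itv hab -> V) :
  exp_bounded M c -> represents c f -> represents (shift 1 c) g ->
  forall x y : itv hab,
    norm (minus (minus (f y) (f x)) (scale F (y - x) (g x)))
      <= (y - x) ^ 2 * (2 * M * exp (4 * (b - a + 1))).
Proof.
intros Hc Hf Hg x y.
pose proof (exp_bounded_ge_0 _ _ Hc) as HM.
pose proof (represents_shift1 c f x Hf) as Hx.
pose proof (represents_shift1 c f y Hf) as Hy.
pose proof (is_series_sub F _ _ _ _ (is_series_sub F _ _ _ _ Hy Hx)
  (is_series_scale F (y - x) _ _ (Hg x))) as H.
replace (minus (minus (f y) (c 0%nat)) (minus (f x) (c 0%nat)))
  with (minus (f y) (f x)) in H
  by (symmetry; apply (minus_minus_cancel (G := V))).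
refine (is_series_norm_le _ _ _ _ _ H
  (is_series_scal (V := R_NormedModule) ((y - x) ^ 2) _ _
     (is_series_scal (V := R_NormedModule) (2 * M) _ _
        (is_series_exp (4 * (b - a + 1)))))).
intros i; cbv beta.
pose proof (itv_offset x) as Bx; pose proof (itv_offset y) as By.
pose proof (INR_fact_lt_0 i) as Hi; pose proof (INR_fact_lt_0 (S i)) as HSi.
rewrite scale_scale, <- !scale_minus_l.
eapply Rle_trans; [apply norm_scale_le |].
set (r := b - a + 1).
pose proof (monomial_taylor r (x - a) (y - a) i) as T.
rewrite !Rabs_right in T by lra.
specialize (T ltac:(unfold r; lra) ltac:(unfold r; lra) ltac:(unfold r; lra)).
replace (y - a - (x - a)) with (y - x) in T by ring.
assert (Hfact : INR (fact (S i)) = INR (S i) * INR (fact i)).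
{ rewrite <- mult_INR; reflexivity. }
assert (HS : 0 < INR (S i)) by apply lt_0_INR, Nat.lt_0_succ.
apply Rle_trans with ((y - x) ^ 2 * (INR i * r ^ i / INR (fact i)) * (M * 2 ^ S i)).
- apply Rmult_le_compat; [apply Rabs_pos | apply norm_ge_0 | |].
  + replace (_ - _) with
     (((y - a) ^ S i - (x - a) ^ S i - INR (S i) * (y - x) * (x - a) ^ i)
       / INR (fact (S i))).
    2:{ rewrite Hfact; field; lra. }
    unfold Rdiv at 1; rewrite Rabs_mult.
    rewrite (Rabs_right (/ _)) by (apply Rle_ge; left; apply Rinv_0_lt_compat, HSi).
    apply Rle_div_l; [exact HSi |].
    eapply Rle_trans; [exact T |].
    rewrite Hfact; apply Req_le; field; lra.
  + unfold shift; rewrite Nat.add_1_r; apply Hc.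
- change (scal ((y - x) ^ 2) (scal (2 * M) ((4 * r) ^ i / INR (fact i)))) with
    ((y - x) ^ 2 * (2 * M * ((4 * r) ^ i / INR (fact i)))).
  rewrite Rmult_assoc; apply Rmult_le_compat_l; [apply pow2_ge_0 |].
  apply Rle_trans with (2 ^ i * r ^ i / INR (fact i) * (M * 2 ^ S i)).
  + apply Rmult_le_compat_r; [pose proof (pow_lt 2 (S i)); nra |].
    apply Rmult_le_compat_r; [left; apply Rinv_0_lt_compat, Hi |].
    apply Rmult_le_compat_r; [apply pow_le; unfold r; lra | apply INR_le_pow2].
  + replace 4 with (2 * 2) by ring; rewrite !Rpow_mult_distr; simpl.
    apply Req_le; field; lra.
Qed.

(** Dividing the quadratic remainder by [y - x] leaves an error of at most [k |y - x|]. As [y] stays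
    in the interval, the endpoints need no separate treatment. *)
Lemma represents_derivative (M : R) (c : nat -> V) (f g : itv hab -> V) :
  exp_bounded M c -> represents c f -> represents (shift 1 c) g ->
  is_derivative F hab f g.
Proof.
intros Hc Hf Hg x.
pose proof (represents_taylor M c f g Hc Hf Hg x) as T.
set (k := 2 * M * exp (4 * (b - a + 1))) in T.
assert (Hk : 0 <= k).
{ pose proof (exp_bounded_ge_0 _ _ Hc); pose proof (exp_pos (4 * (b - a + 1))).
  unfold k; nra. }
apply (filterlim_locally_ball_norm (U := V)); intros eps.
assert (He : 0 < eps / (k + 1)) by (apply Rdiv_lt_0_compat; [apply cond_pos | lra]).
exists (mkposreal _ He); intros y Hy Hne; unfold ball_norm.
change (Rabs (y - x) < eps / (k + 1)) in Hy.
assert (Hd : pt y - pt x <> 0) by (intros E; apply Hne, pt_inj; lra).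
change (norm (minus (scale F (/ (y - x)) (minus (f y) (f x))) (g x)) < eps).
replace (minus _ (g x)) with
  (scale F (/ (y - x)) (minus (minus (f y) (f x)) (scale F (y - x) (g x)))).
2:{ unfold minus at 1; rewrite scale_plus_r, scale_opp_r, scale_scale.
    rewrite Rinv_l, scale_one by exact Hd; reflexivity. }
eapply Rle_lt_trans; [apply norm_scale_le |].
apply Rle_lt_trans with (Rabs (/ (y - x)) * ((y - x) ^ 2 * k)).
{ apply Rmult_le_compat_l; [apply Rabs_pos | apply T]. }
rewrite Rabs_inv, <- (pow2_abs (y - x)).
assert (0 < Rabs (y - x)) by (apply Rabs_pos_lt, Hd).
replace (/ Rabs (y - x) * (Rabs (y - x) ^ 2 * k)) with (Rabs (y - x) * k)
  by (field; lra).
apply Rlt_div_r in Hy; nra.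
Qed.

Lemma represents_continuous (M : R) (c : nat -> V) (f : itv hab -> V) :
  exp_bounded M c -> represents c f -> forall x, continuous f x.
Proof.
intros Hc Hf x.
destruct (represents_ex _ _ (exp_bounded_shift M c 1 Hc)) as [g Hg].
pose proof (represents_taylor M c f g Hc Hf Hg x) as T.
set (k := 2 * M * exp (4 * (b - a + 1))) in T.
assert (Hk : 0 <= k).
{ pose proof (exp_bounded_ge_0 _ _ Hc); pose proof (exp_pos (4 * (b - a + 1))).
  unfold k; nra. }
(* With [|y - x| <= b - a], the linear and quadratic terms together give
   [|f y - f x| <= l |y - x|]. *)
set (l := norm (g x) + (b - a) * k).
assert (Hl : 0 <= l).
{ unfold l; pose proof (norm_ge_0 (g x)); nra. }
apply (filterlim_locally_ball_norm (U := V)); intros eps.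
assert (He : 0 < eps / (l + 1)) by (apply Rdiv_lt_0_compat; [apply cond_pos | lra]).
exists (mkposreal _ He); intros y Hy; unfold ball_norm.
change (Rabs (y - x) < eps / (l + 1)) in Hy.
apply Rle_lt_trans with (Rabs (y - x) * l).
- replace (minus (f y) (f x)) with
    (plus (minus (minus (f y) (f x)) (scale F (y - x) (g x))) (scale F (y - x) (g x))).
  2:{ apply (minus_plus_cancel (G := V)). }
  eapply Rle_trans; [apply (norm_triangle (V := V)) |].
  specialize (T y); pose proof (norm_scale_le F (y - x) (g x)) as S.
  assert (Hb : Rabs (y - x) <= b - a).
  { pose proof (itv_offset x); pose proof (itv_offset y); apply Rabs_le; lra. }
  rewrite <- (pow2_abs (y - x)) in T; pose proof (Rabs_pos (y - x)).
  assert (Rabs (y - x) ^ 2 * k <= Rabs (y - x) * ((b - a) * k)).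
  { simpl; rewrite Rmult_1_r, Rmult_assoc; apply Rmult_le_compat_l; [lra |].
    apply Rmult_le_compat_r; lra. }
  unfold l; lra.
- apply Rlt_div_r in Hy; [| lra].
  pose proof (Rabs_pos (y - x)); lra.
Qed.

Lemma shift_shift (k l : nat) (c : nat -> V) :
  shift k (shift l c) = shift (k + l) c.
Proof.
apply functional_extensionality; intros i; unfold shift; f_equal; lia.
Qed.

Lemma represents_nth_derivative (M : R) (c : nat -> V) (n : nat)
    (f g : itv hab -> V) :
  exp_bounded M c -> represents c f -> represents (shift n c) g ->
  is_nth_derivative F hab n f g.
Proof.
intros Hc Hf; revert g; induction n as [| n IH]; simpl; intros g Hg.
- apply (represents_unique c); [exact Hf |].
  replace c with (shift 0 c); [exact Hg |].
  apply functional_extensionality; intros i; unfold shift; f_equal; lia.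
- pose proof (exp_bounded_shift M c n Hc) as Hn.
  destruct (represents_ex _ _ Hn) as [h Hh].
  exists h; split; [now apply IH |].
  apply (represents_derivative _ _ _ _ Hn Hh).
  rewrite shift_shift; exact Hg.
Qed.

Lemma represents_graph (M : R) (c : nat -> V) (n : nat) (f g : C_itv hab V) :
  exp_bounded M c -> represents c f -> represents (shift n c) g ->
  graph (derivative_operator F hab n) f g.
Proof.
intros Hc Hf Hg; split.
- intros k _; pose proof (exp_bounded_shift M c k Hc) as Hk.
  destruct (represents_ex _ _ Hk) as [h Hh]; exists h; split.
  + now apply (represents_nth_derivative M c).
  + exact (represents_continuous _ _ _ Hk Hh).
- now apply (represents_nth_derivative M c).
Qed.

Lemma represents_C_ex (M : R) (c : nat -> V) :
  exp_bounded M c -> exists f : C_itv hab V, represents c f.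
Proof.
intros Hc; destruct (represents_ex M c Hc) as [f Hf].
exists (C_Itv f (represents_continuous M c f Hc Hf)); exact Hf.
Qed.

Lemma represents_op_pow (M : R) (c : nat -> V) (n m : nat) (f g : C_itv hab V) :
  exp_bounded M c -> represents c f -> represents (shift (n * m) c) g ->
  op_pow (derivative_operator F hab n) m f g.
Proof.
intros Hc Hf; revert g; induction m as [| m IH]; simpl; intros g Hg.
- apply C_itv_ext; intros x.
  apply (f_equal (fun h => h x)), (represents_unique c); [exact Hf |].
  replace c with (shift (n * 0) c); [exact Hg |].
  apply functional_extensionality; intros i; unfold shift; f_equal; lia.
- pose proof (exp_bounded_shift M c (n * m) Hc) as Hm.
  destruct (represents_C_ex _ _ Hm) as [h Hh].
  exists h; split; [now apply IH |].
  apply (represents_graph _ _ _ _ _ Hm Hh).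
  rewrite shift_shift; replace (n + n * m)%nat with (n * S m)%nat by lia; exact Hg.
Qed.

(** * Polynomials and Weierstrass's theorem *)

Definition is_polynomial (f : itv hab -> V) : Prop :=
  exists c m, (forall i, (m < i)%nat -> c i = zero) /\ represents c f.

Lemma is_polynomial_const (v : V) : is_polynomial (fun _ => v).
Proof.
exists (fun i => match i with O => v | S _ => zero end), 0%nat; split.
- intros [| i] Hi; [lia | reflexivity].
- intros x.
  refine (eq_ind _ (is_series _) (is_series_finite (V := V) _ 0 _) _ _).
  + intros [| i] Hi; [lia | apply scale_zero_r].
  + rewrite sum_O; simpl; rewrite Rdiv_1_r; apply scale_one.
Qed.

Lemma is_polynomial_plus (f g : itv hab -> V) :
  is_polynomial f -> is_polynomial g ->
  is_polynomial (fun x => plus (f x) (g x)).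
Proof.
intros [c [m [Hc Hf]]] [d [p [Hd Hg]]].
exists (fun i => plus (c i) (d i)), (m + p)%nat; split.
- intros i Hi; rewrite Hc, Hd by lia; apply (plus_zero_r (G := V)).
- now apply represents_plus.
Qed.

Lemma is_polynomial_scale (r : R) (f : itv hab -> V) :
  is_polynomial f -> is_polynomial (fun x => scale F r (f x)).
Proof.
intros [c [m [Hc Hf]]]; exists (fun i => scale F r (c i)), m; split.
- intros i Hi; rewrite Hc by exact Hi; apply scale_zero_r.
- now apply represents_scale.
Qed.

(** Coefficients move up by one index; the factor [i + 1] turns [1 / i!] into the normalization
    [1 / (i + 1)!]. *)
Lemma is_polynomial_mult_offset (f : itv hab -> V) :
  is_polynomial f -> is_polynomial (fun x => scale F (x - a) (f x)).
Proof.
intros [c [m [Hc Hf]]].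
exists (fun i => match i with O => zero | S i => scale F (INR (S i)) (c i) end),
  (S m); split.
- intros [| i] Hi; [lia |]; rewrite Hc by lia; apply scale_zero_r.
- intros x; apply (is_series_decr_1 (V := V)).
  replace (plus _ _) with (scale F (x - a) (f x)).
  2:{ rewrite scale_zero_r; symmetry.
      etransitivity; [| apply (plus_zero_r (G := V))].
      f_equal; apply (opp_zero (G := V)). }
  eapply is_series_ext; [| exact (is_series_scale F (x - a) _ _ (Hf x))].
  intros i; cbv beta iota; rewrite !scale_scale; f_equal.
  change (fact (S i)) with (S i * fact i)%nat; rewrite mult_INR; simpl pow.
  pose proof (INR_fact_lt_0 i); pose proof (lt_0_INR (S i) (Nat.lt_0_succ i)).
  field; lra.
Qed.

Lemma is_polynomial_ext (f g : itv hab -> V) :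
  (forall x, f x = g x) -> is_polynomial f -> is_polynomial g.
Proof. intros E; apply functional_extensionality in E; now subst. Qed.

(** With [X] the sum of [j] independent Bernoulli variables of mean [t], this is
    the expectation of [g (s + h X)]; for [h = (b - a) / j] and [s = a] it is the
    [j]th Bernstein polynomial of [g] on [a, b]. *)
Fixpoint bernstein (g : R -> V) (h t : R) (j : nat) (s : R) : V :=
  match j with
  | O => g s
  | S j => plus (scale F t (bernstein g h t j (s + h)))
             (scale F (1 - t) (bernstein g h t j s))
  end.

Lemma is_polynomial_bernstein (g : R -> V) (h s : R) (j : nat) :
  is_polynomial (fun x => bernstein g h ((x - a) / (b - a)) j s).
Proof.
revert s; induction j as [| j IH]; intros s; simpl.
- apply is_polynomial_const.
- assert (H : forall p, is_polynomial p ->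
     is_polynomial (fun x => scale F ((x - a) / (b - a)) (p x))).
  { intros p Hp.
    apply (is_polynomial_ext (fun x => scale F (/ (b - a)) (scale F (x - a) (p x)))).
    - intros x; rewrite scale_scale; f_equal; apply Rmult_comm.
    - now apply is_polynomial_scale, is_polynomial_mult_offset. }
  apply is_polynomial_plus; [now apply H |].
  (* The factor [1 - t] is written as [p - t p], which reduces it to multiplication by [t]. *)
  apply (is_polynomial_ext (fun x =>
    plus (bernstein g h ((x - a) / (b - a)) j s)
      (scale F (-1)
         (scale F ((x - a) / (b - a)) (bernstein g h ((x - a) / (b - a)) j s))))).
  + intros x; set (v := bernstein _ _ _ _ _).
    rewrite <- (scale_one F v) at 1.
    rewrite scale_scale, <- scale_plus_l; f_equal; ring.
  + apply is_polynomial_plus; [apply IH |].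
    apply is_polynomial_scale, H, IH.
Qed.

(* [(s + j t h - x)^2 + j t (1 - t) h^2] is the expectation of
   [(s + h X - x)^2] for [X] binomial of parameters [j] and [t]. *)
Lemma bernstein_error (g : R -> V) (v : V) (h t x A B s : R) (j : nat) :
  0 <= t <= 1 ->
  (forall s, norm (minus (g s) v) <= A + B * (s - x) ^ 2) ->
  norm (minus (bernstein g h t j s) v)
    <= A + B * ((s + INR j * t * h - x) ^ 2 + INR j * t * (1 - t) * h ^ 2).
Proof.
intros Ht Hg; revert s; induction j as [| j IH]; intros s.
- simpl; eapply Rle_trans; [apply Hg |]; apply Req_le; ring.
- simpl bernstein.
  replace (minus _ v) with
    (plus (scale F t (minus (bernstein g h t j (s + h)) v))
       (scale F (1 - t) (minus (bernstein g h t j s) v))).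
  2:{ rewrite !scale_minus_r; symmetry.
      replace v with (plus (scale F t v) (scale F (1 - t) v)) at 1.
      - apply (minus_plus_plus (G := V)).
      - rewrite <- scale_plus_l; replace (t + (1 - t)) with 1 by ring.
        apply scale_one. }
  eapply Rle_trans; [apply (norm_triangle (V := V)) |].
  eapply Rle_trans; [apply Rplus_le_compat; apply norm_scale_le |].
  rewrite !Rabs_right by lra.
  eapply Rle_trans;
    [apply Rplus_le_compat; apply Rmult_le_compat_l; [lra | apply IH | lra | apply IH] |].
  rewrite S_INR; apply Req_le; ring.
Qed.

(** This is Bernstein's argument: uniform continuity bounds the oscillation of [f] by [eps / 2] plus
    a multiple of the squared distance, and the expectation of the latter is a variance of order
    [1 / m]. *)
Lemma polynomial_dense (f : C_itv hab V) (eps : R) : 0 < eps ->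
  exists p, is_polynomial p /\ forall x, norm (minus (p x) (f x)) < eps.
Proof.
intros He.
assert (He2 : 0 < eps / 2) by lra.
(* Composition with [clamp] extends [f] continuously to the real line. *)
destruct (unifcont_normed_1d (fun s => f (clamp hab s)) a b) with
  (eps := mkposreal _ He2) as [d Hd].
{ intros s _; apply (filterlim_comp _ _ _ (clamp hab) f _ (locally (clamp hab s)));
    [| apply fct_continuous].
  apply filterlim_locally; intros eta; exists eta; intros y Hy.
  change (Rabs (clamp hab y - clamp hab s) < eta).
  eapply Rle_lt_trans; [apply clamp_lip | exact Hy]. }
pose proof (cond_pos d) as Hd0.
set (T := sup_norm hab V f).
(* At distance at least [d] the trivial bound [2 T] on the difference is at most [B (s - x)^2]. *)
set (B := 2 * T / d ^ 2).
assert (HT : 0 <= T).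
{ apply Rle_trans with (norm (f (itv_left hab))); [apply norm_ge_0 |].
  apply (sup_norm_ub hab V f). }
assert (HB : 0 <= B) by (apply Rdiv_le_0_compat; [lra | apply pow_lt, Hd0]).
assert (Herr : forall (x : itv hab) s,
  norm (minus (f (clamp hab s)) (f x)) <= eps / 2 + B * (s - x) ^ 2).
{ intros x s.
  pose proof (pow2_ge_0 (s - x)) as Hsq.
  destruct (Rlt_le_dec (Rabs (clamp hab s - x)) d) as [Hlt | Hge].
  - assert (norm (minus (f (clamp hab s)) (f x)) < eps / 2).
    { pose proof (Hd x (clamp hab s) (pt_bounds x) (pt_bounds _) Hlt) as H.
      unfold ball_norm in H; rewrite !clamp_pt in H; exact H. }
    nra.
  - assert (H2 : norm (minus (f (clamp hab s)) (f x)) <= 2 * T).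
    { unfold minus; eapply Rle_trans; [apply (norm_triangle (V := V)) |].
      rewrite (norm_opp (V := V)).
      pose proof (sup_norm_ub hab V f x) as H.
      pose proof (sup_norm_ub hab V f (clamp hab s)) as H0.
      fold T in H, H0; lra. }
    assert (Hsx : d <= Rabs (s - x)).
    { eapply Rle_trans; [exact Hge |].
      rewrite <- (clamp_pt hab x) at 1; apply clamp_lip. }
    assert (d ^ 2 <= (s - x) ^ 2).
    { rewrite <- (pow2_abs (s - x)); apply pow_incr; lra. }
    assert (B * d ^ 2 = 2 * T) by (unfold B; field; lra).
    nra. }
(* The degree [m = S j] exceeds [2 B (b - a)^2 / eps], which makes the variance term less than
   [eps / 2]. *)
destruct (nfloor_ex (Rabs (2 * B * (b - a) ^ 2 / eps)) (Rabs_pos _)) as [j [_ Hj]].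
rewrite <- S_INR in Hj; apply (Rle_lt_trans _ _ _ (Rle_abs _)) in Hj.
pose proof (lt_0_INR _ (Nat.lt_0_succ j)) as Hj0.
set (m := S j) in *.
exists (fun x => bernstein (fun s => f (clamp hab s)) ((b - a) / INR m)
                   ((x - a) / (b - a)) m a); split.
- apply is_polynomial_bernstein.
- intros x.
  set (t := (x - a) / (b - a)).
  assert (Ht : 0 <= t <= 1).
  { pose proof (itv_offset x); unfold t; split.
    - apply Rdiv_le_0_compat; lra.
    - apply Rle_div_l; lra. }
  eapply Rle_lt_trans; [apply (bernstein_error _ _ _ _ x (eps / 2) B _ _ Ht (Herr x)) |].
  (* The mean of the sample point is exactly [x], so only the variance remains. *)
  replace (a + INR m * t * ((b - a) / INR m) - x) with 0 by (unfold t; field; lra).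
  replace (INR m * t * (1 - t) * ((b - a) / INR m) ^ 2)
    with (t * (1 - t) * ((b - a) ^ 2 / INR m)) by (field; lra).
  apply Rlt_div_l in Hj; [| exact He].
  assert (B * ((b - a) ^ 2 / INR m) < eps / 2).
  { replace (B * ((b - a) ^ 2 / INR m)) with (B * (b - a) ^ 2 / INR m) by (field; lra).
    apply Rlt_div_l; [exact Hj0 | lra]. }
  assert (0 <= (b - a) ^ 2 / INR m).
  { apply Rdiv_le_0_compat; [apply pow2_ge_0 | exact Hj0]. }
  assert (0 <= B * ((b - a) ^ 2 / INR m)) by nra.
  assert (t * (1 - t) <= 1) by nra.
  replace (B * (0 ^ 2 + t * (1 - t) * ((b - a) ^ 2 / INR m)))
    with (t * (1 - t) * (B * ((b - a) ^ 2 / INR m))) by ring.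
  nra.
Qed.

(** * Density of the periodic points *)

Lemma C_ball_intro (f g : C_itv hab V) (eps : R) :
  (forall x, norm (minus (g x) (f x)) < eps) -> C_ball hab V f eps g.
Proof.
intros H; unfold C_ball.
(* The maximum is attained, so the strict pointwise inequality passes to the norm. *)
destruct (sup_norm_max hab V (minus g f)) as [x [-> _]]; apply H.
Qed.

Lemma finite_support_bounded (c : nat -> V) (m : nat) :
  (forall i, (m < i)%nat -> c i = zero) ->
  exists M, forall i, norm (c i) <= M.
Proof.
intros Hc.
assert (H : forall k, exists M, 0 <= M /\ forall i, (i <= k)%nat -> norm (c i) <= M).
{ induction k as [| k [M [HM IH]]].
  - exists (norm (c 0%nat)); split; [apply norm_ge_0 |].
    intros i Hi; replace i with 0%nat by lia; lra.
  - exists (M + norm (c (S k))); pose proof (norm_ge_0 (c (S k))) as Hn; split; [lra |].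
    intros i Hi; destruct (Nat.eq_dec i (S k)) as [-> | Hne]; [lra |].
    specialize (IH i ltac:(lia)); lra. }
destruct (H m) as [M [HM Hle]]; exists M; intros i.
destruct (Nat.le_gt_cases i m) as [Hi | Hi]; [now apply Hle |].
rewrite Hc by exact Hi; rewrite (norm_zero (V := V)); exact HM.
Qed.

Lemma bounded_exp_bounded (M : R) (c : nat -> V) :
  (forall i, norm (c i) <= M) -> exp_bounded M c.
Proof.
intros H i; pose proof (norm_ge_0 (c i)); specialize (H i).
pose proof (pow_R1_Rle 2 i); nra.
Qed.

Lemma periodic_points_dense (n : nat) : (1 <= n)%nat ->
  dense (X := C_itv_UniformSpace hab V)
    (periodic_point (derivative_operator F hab n)).
Proof.
intros Hn f eps; pose proof (cond_pos eps) as He.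
destruct (polynomial_dense f (eps / 2)) as [p [[c [m [Hc Hp]]] Hpf]]; [lra |].
destruct (finite_support_bounded c m Hc) as [M HM].
destruct (represents_tail M (eps / 2)) as [m0 Ht]; [lra |].
(* [P > m] puts all nonzero coefficients of [p] into the first period; [P > m0] makes the two
   sequences agree as far as [represents_tail] asks. *)
set (N := S (m + m0)); set (P := (n * N)%nat).
assert (HP : (m < P /\ m0 < P)%nat) by (unfold P, N; nia).
set (c' := fun i => c (i mod P)).
assert (Hc' : exp_bounded M c') by (apply bounded_exp_bounded; intros i; apply HM).
destruct (represents_C_ex M c' Hc') as [g Hg].
exists g; split.
- exists N; split; [unfold N; lia |].
  apply (represents_op_pow M c'); [exact Hc' | exact Hg |].
  replace (shift (n * N) c') with c'; [exact Hg |].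
  apply functional_extensionality; intros i; unfold shift, c'; f_equal.
  fold P; rewrite <- (Nat.mul_1_l P) at 2; symmetry; apply Nat.Div0.mod_add.
- apply C_ball_intro; intros x.
  assert (Hgp : norm (minus (g x) (p x)) < eps / 2).
  { refine (Ht _ _ _ _ (represents_minus _ _ _ _ Hg Hp) x).
    (* The difference is zero on the first period and [c (i mod P)] afterwards, so the bound [M]
       fixed before [P] still holds. *)
    - apply bounded_exp_bounded; intros i; unfold c'.
      destruct (Nat.lt_ge_cases i P) as [Hi | Hi].
      + rewrite Nat.mod_small by exact Hi.
        replace (minus (c i) (c i)) with (zero : V)
          by (symmetry; apply (minus_eq_zero (G := V))).
        rewrite (norm_zero (V := V)).
        apply Rle_trans with (2 := HM 0%nat), norm_ge_0.
      + rewrite (Hc i) by lia.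
        eapply Rle_trans; [| apply (HM (i mod P))].
        apply Req_le, (f_equal norm), (minus_zero_r (G := V)).
    - intros i Hi; unfold c'; rewrite Nat.mod_small by lia.
      apply (minus_eq_zero (G := V)). }
  pose proof (norm_minus_triangle (V := V) (g x) (p x) (f x)); specialize (Hpf x); lra.
Qed.

(** * A countable dense set of scalars and the hypercyclic vector *)

Lemma scalar_space_nontrivial :
  exists v : V, 0 < norm v.
Proof.
destruct F; simpl.
- exists 1; change (0 < Rabs 1); rewrite Rabs_R1; exact Rlt_0_1.
- exists (RtoC 1); change (0 < Cmod 1); rewrite Cmod_1; exact Rlt_0_1.
Qed.

(** The difference of two naturals gives either sign, and the added 1 keeps the denominator
    positive. Entries after the third are ignored, so a second rational can follow in the same
    list. *)
Definition coded_rational (l : list nat) : R :=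
  (INR (nth 0 l 0%nat) - INR (nth 1 l 0%nat)) / (INR (nth 2 l 0%nat) + 1).

Lemma coded_rational_dense (x eps : R) : 0 < eps ->
  exists p q r, forall l, Rabs (coded_rational (p :: q :: r :: l) - x) < eps.
Proof.
intros He.
assert (Hinv : 0 < / eps) by (apply Rinv_0_lt_compat, He).
(* The grid of step [1 / (r + 1) < eps] is fine enough; [k] rounds [|x| (r + 1)] down. *)
destruct (nfloor_ex (/ eps) (Rlt_le _ _ Hinv)) as [r [_ Hr]].
pose proof (pos_INR r) as Hr0.
destruct (nfloor_ex (Rabs x * (INR r + 1))) as [k [Hk1 Hk2]].
{ pose proof (Rabs_pos x); nra. }
assert (H : Rabs (INR k / (INR r + 1) - Rabs x) < eps).
{ replace (INR k / (INR r + 1) - Rabs x)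
    with (- ((Rabs x * (INR r + 1) - INR k) / (INR r + 1))) by (field; lra).
  rewrite Rabs_Ropp, Rabs_right by (apply Rle_ge, Rdiv_le_0_compat; lra).
  apply Rlt_div_l; [lra |].
  apply Rlt_le_trans with 1; [lra |].
  apply Rle_trans with (eps * / eps); [apply Req_le; field; lra |].
  apply Rmult_le_compat_l; lra. }
destruct (Rle_dec 0 x) as [Hx | Hx].
- exists k, 0%nat, r; intros l; unfold coded_rational; simpl nth; simpl (INR 0).
  rewrite Rminus_0_r; rewrite (Rabs_right x) in H by lra; exact H.
- exists 0%nat, k, r; intros l; unfold coded_rational; simpl nth; simpl (INR 0).
  rewrite (Rabs_left x) in H by lra; rewrite <- Rabs_Ropp.
  replace (- ((0 - INR k) / (INR r + 1) - x)) with (INR k / (INR r + 1) - - x)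
    by (field; lra).
  exact H.
Qed.

(** [CodeSeq] encodes lists of naturals as naturals. Hence a single natural names a scalar, a list
    of naturals names a finite sequence of scalars, and a natural again names such a list. *)
Definition coded_scalar (j : nat) : V :=
  let l := choice.CodeSeq.decode j in
  match F return CompleteNormedModule.NormedModule _ (scalar_space F) with
  | Real => coded_rational l
  | Complex => (coded_rational l, coded_rational (skipn 3 l))
  end.

Lemma coded_scalar_dense (v : V) (eps : R) : 0 < eps ->
  exists j, norm (minus (coded_scalar j) v) < eps.
Proof.
unfold coded_scalar; destruct F; intros He.
- destruct (coded_rational_dense v eps He) as [p [q [r H]]].
  exists (choice.CodeSeq.code (p :: q :: r :: nil)).
  rewrite choice.CodeSeq.codeK; apply H.
- destruct v as [x y].
  destruct (coded_rational_dense x (eps / 2)) as [p [q [r H]]]; [lra |].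
  destruct (coded_rational_dense y (eps / 2)) as [p' [q' [r' H']]]; [lra |].
  exists (choice.CodeSeq.code (p :: q :: r :: p' :: q' :: r' :: nil)).
  rewrite choice.CodeSeq.codeK; simpl skipn.
  specialize (H (p' :: q' :: r' :: nil)); specialize (H' nil).
  set (s := coded_rational _) in *; set (t := coded_rational (p' :: _)) in *.
  change (Cmod (Cminus (s, t) (x, y)) < eps).
  replace (Cminus (s, t) (x, y))
    with (Cplus (RtoC (s - x)) (Cmult Ci (RtoC (t - y))))
    by (apply injective_projections; simpl; ring).
  eapply Rle_lt_trans; [apply Cmod_triangle |].
  rewrite Cmod_mult, !Cmod_R, Cmod_Ci; lra.
Qed.

Definition coefficients (l : list nat) (i : nat) : V :=
  match nth_error l i with Some j => coded_scalar j | None => zero end.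

Lemma coefficients_out (l : list nat) (i : nat) :
  (length l <= i)%nat -> coefficients l i = zero.
Proof. intros H; unfold coefficients; now rewrite (proj2 (nth_error_None l i) H). Qed.

Lemma coefficients_dense (c : nat -> V) (m : nat) (eps : R) : 0 < eps ->
  (forall i, (m < i)%nat -> c i = zero) ->
  exists l, forall i, norm (minus (coefficients l i) (c i)) <= eps.
Proof.
intros He; revert c; induction m as [| m IH]; intros c Hc.
- destruct (coded_scalar_dense (c 0%nat) eps He) as [j Hj].
  exists (j :: nil); intros [| i]; [apply Rlt_le, Hj |].
  rewrite Hc, coefficients_out by (simpl; lia).
  apply Rle_trans with (norm (zero : V)); [| rewrite (norm_zero (V := V)); lra].
  apply Req_le, (f_equal norm), (minus_eq_zero (G := V)).
- destruct (IH (fun i => c (S i))) as [l Hl]; [intros i Hi; apply Hc; lia |].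
  destruct (coded_scalar_dense (c 0%nat) eps He) as [j Hj].
  exists (j :: l); intros [| i]; [apply Rlt_le, Hj | apply Hl].
Qed.

Lemma coefficients_approx (f : C_itv hab V) (eps : R) : 0 < eps ->
  exists l p, represents (coefficients l) p /\
    forall x, norm (minus (p x) (f x)) < eps.
Proof.
intros He.
destruct (polynomial_dense f (eps / 2)) as [q [[c [m [Hc Hq]]] Hqf]]; [lra |].
pose proof (exp_pos (2 * (b - a))) as HE.
(* By [represents_norm_le] a uniform coefficient error costs at most a factor [exp (2 (b - a))], so
   this one costs [eps / 2]. *)
destruct (coefficients_dense c m (eps / 2 / exp (2 * (b - a)))) as [l Hl];
  [apply Rdiv_lt_0_compat; lra | exact Hc |].
destruct (finite_support_bounded (coefficients l) (length l)) as [M HM].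
{ intros i Hi; apply coefficients_out; lia. }
destruct (represents_ex M _ (bounded_exp_bounded _ _ HM)) as [p Hp].
exists l, p; split; [exact Hp |]; intros x.
pose proof (represents_norm_le _ _ _ x (bounded_exp_bounded _ _ Hl)
  (represents_minus _ _ _ _ Hp Hq)) as H; cbv beta in H.
replace (eps / 2 / exp (2 * (b - a)) * exp (2 * (b - a))) with (eps / 2) in H
  by (field; lra).
pose proof (norm_minus_triangle (V := V) (p x) (q x) (f x)); specialize (Hqf x); lra.
Qed.

(* Dropping the head of [decode k] makes every list occur for arbitrarily large
   [k]. *)
Definition block (k i : nat) : V :=
  let v := coefficients (tl (choice.CodeSeq.decode k)) i in
  if Rle_dec (norm v) (INR k) then v else zero.

(** Block [k] occupies the indices from [n * 2 ^ k] to [n * 2 ^ (k + 1) - 1]. *)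
Definition universal (n j : nat) : V :=
  let k := Nat.log2 (j / n) in block k (j - n * 2 ^ k).

(** The cutoff in [block] serves this bound, from which the linear growth of [universal] follows. *)
Lemma norm_block (k i : nat) : norm (block k i) <= INR k.
Proof.
unfold block; destruct Rle_dec as [H | H]; [exact H |].
rewrite (norm_zero (V := V)); apply pos_INR.
Qed.

Lemma norm_universal (n j : nat) : (1 <= n)%nat -> norm (universal n j) <= INR j.
Proof.
intros Hn; unfold universal; eapply Rle_trans; [apply norm_block |].
apply le_INR; apply Nat.le_trans with (j / n)%nat.
- apply Nat.log2_le_lin; lia.
- apply Nat.Div0.div_le_upper_bound; nia.
Qed.

(** The quotient of [i + n 2^k] by [n] lies in [[2^k, 2^(k + 1))], so its binary logarithm recovers
    [k]. *)
Lemma universal_block (n k i : nat) : (i < n * 2 ^ k)%nat ->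
  universal n (i + n * 2 ^ k) = block k i.
Proof.
intros Hi; assert (Hn : n <> 0%nat) by lia.
unfold universal.
replace (Nat.log2 ((i + n * 2 ^ k) / n)) with k; [f_equal; lia |].
symmetry; rewrite (Nat.mul_comm n), Nat.div_add by exact Hn.
apply (Nat.log2_unique' _ k (i / n)); [lia | | lia].
split; [lia | apply Nat.Div0.div_lt_upper_bound; exact Hi].
Qed.

(** Every entry of a list is smaller than its code. A large head thus yields a block with a large
    index, long enough for its zeros and with a cutoff above the coefficients of [l]. *)
Lemma code_gt (N : nat) (l : list nat) : (N < choice.CodeSeq.code (N :: l))%nat.
Proof.
pose proof (choice.CodeSeq.ltn_code (N :: l)) as Hlt.
apply andb_prop in Hlt; destruct Hlt as [Hlt _].
exact (ssrbool.elimT ssrnat.ltP Hlt).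
Qed.

Lemma block_code (N : nat) (l : list nat) (i : nat) :
  norm (coefficients l i) <= INR N ->
  block (choice.CodeSeq.code (N :: l)) i = coefficients l i.
Proof.
intros H; unfold block; rewrite choice.CodeSeq.codeK; simpl tl.
destruct Rle_dec as [_ | Hn]; [reflexivity |].
exfalso; apply Hn; eapply Rle_trans; [exact H |].
apply le_INR, Nat.lt_le_incl, code_gt.
Qed.

Lemma universal_exp_bounded (n : nat) : (1 <= n)%nat -> exp_bounded 1 (universal n).
Proof.
intros Hn j; rewrite Rmult_1_l.
eapply Rle_trans; [apply norm_universal, Hn | apply INR_le_pow2].
Qed.

Lemma universal_orbit_dense (n : nat) (f : C_itv hab V) : (1 <= n)%nat ->
  represents (universal n) f ->
  dense (X := C_itv_UniformSpace hab V) (orbit (derivative_operator F hab n) f).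
Proof.
intros Hn Hf g eps; pose proof (cond_pos eps) as He.
pose proof (universal_exp_bounded n Hn) as Hu.
destruct (coefficients_approx g (eps / 2)) as [l [p [Hp Hpg]]]; [lra |].
destruct (finite_support_bounded (coefficients l) (length l)) as [M HM].
{ intros i Hi; apply coefficients_out; lia. }
destruct (nfloor_ex (Rabs M) (Rabs_pos M)) as [M' [_ HM']].
rewrite <- S_INR in HM'.
destruct (represents_tail 1 (eps / 2)) as [m0 Ht]; [lra |].
(* [S M'] passes the cutoff, [m0] makes the agreement long enough, and [length l] makes the list fit
   into its block. *)
set (N := (S M' + m0 + length l)%nat).
set (k := choice.CodeSeq.code (N :: l)).
pose proof (code_gt N l) as Hk; fold k in Hk.
pose proof (Nat.pow_gt_lin_r 2 k ltac:(lia)) as Hk2.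
assert (Hs : (S M' + m0 + length l < n * 2 ^ k)%nat) by (unfold N in Hk; nia).
assert (Hb : forall i, (i < n * 2 ^ k)%nat ->
   shift (n * 2 ^ k) (universal n) i = coefficients l i).
{ intros i Hi; unfold shift; rewrite universal_block by exact Hi.
  apply block_code; eapply Rle_trans; [apply HM |].
  apply Rle_trans with (Rabs M); [apply Rle_abs |].
  apply Rle_trans with (INR (S M')); [lra | apply le_INR; unfold N; lia]. }
pose proof (exp_bounded_shift _ _ (n * 2 ^ k) Hu) as Hus.
destruct (represents_C_ex _ _ Hus) as [h Hh].
exists h; split.
(* The power [2^k] of the operator shifts by [n 2^k], which brings block [k] to the front. *)
- exists (2 ^ k)%nat; exact (represents_op_pow 1 _ n _ f h Hu Hf Hh).
- apply C_ball_intro; intros x.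
  assert (Hhp : norm (minus (h x) (p x)) < eps / 2).
  { refine (Ht _ _ _ _ (represents_minus _ _ _ _ Hh Hp) x).
    (* The constant must be 1 whatever [k] is, since [m0] was chosen first; the constant of
       [exp_bounded_shift] would grow with [k]. Inside the block the difference vanishes; beyond it,
       [i >= n 2^k] and linear growth give [i + n 2^k <= 2 i <= 2^i]. *)
    - intros i; rewrite Rmult_1_l.
      destruct (Nat.lt_ge_cases i (n * 2 ^ k)) as [Hi | Hi].
      + rewrite Hb by exact Hi.
        apply Rle_trans with (norm (zero : V)).
        * apply Req_le, (f_equal norm), (minus_eq_zero (G := V)).
        * rewrite (norm_zero (V := V)); apply pow_le; lra.
      + rewrite (coefficients_out l i) by lia.
        apply Rle_trans with (norm (shift (n * 2 ^ k) (universal n) i)).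
        * apply Req_le, (f_equal norm), (minus_zero_r (G := V)).
        * unfold shift; eapply Rle_trans; [apply norm_universal, Hn |].
          apply Rle_trans with (INR (2 * i)); [apply le_INR; lia |].
          apply INR_double_le_pow2; lia.
    - intros i Hi; rewrite Hb by lia; apply (minus_eq_zero (G := V)). }
  pose proof (norm_minus_triangle (V := V) (h x) (p x) (g x)); specialize (Hpg x); lra.
Qed.

(** The orbit of zero is at most zero itself, which misses the ball of radius [norm v] around a
    nonzero constant [v]. *)
Lemma dense_orbit_nonzero (A : linear_operator (C_itv_NormedModule hab V))
    (f : C_itv hab V) :
  dense (X := C_itv_UniformSpace hab V) (orbit A f) -> f <> C_zero hab V.
Proof.
intros Hd ->; destruct scalar_space_nontrivial as [v Hv].
destruct (Hd (C_Itv (fun _ => v) (fun x => continuous_const v x)) (mkposreal _ Hv))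
  as [y [[m Hm] Hy]].
apply (op_pow_zero (X := C_itv_NormedModule hab V)) in Hm; subst y.
pose proof (sup_norm_ub hab V (minus (C_zero hab V)
  (C_Itv (fun _ => v) (fun x => continuous_const v x))) (itv_left hab)) as H.
pose proof (Rle_lt_trans _ _ _ H Hy) as H1.
change (norm (minus (zero : V) v) < norm v) in H1.
rewrite (norm_minus_sym (V := V)) in H1.
apply (Rlt_not_le _ _ H1), Req_le, (f_equal norm); symmetry.
apply (minus_zero_r (G := V)).
Qed.

End Interval.

Theorem theorem3p1 (F : scalar_field) (a b : R) (hab : a < b)
    (n : nat) (hn : (1 <= n)%nat) :
  chaotic (X := C_itv_CompleteNormedModule hab (scalar_space F))
    (derivative_operator F hab n).
Proof.
split; [| exact (periodic_points_dense F hab n hn)].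
pose proof (universal_exp_bounded F n hn) as Hu.
destruct (represents_C_ex F hab 1 _ Hu) as [f Hf].
pose proof (universal_orbit_dense F hab n f hn Hf) as Hd.
exists f; split; [| split; [| exact Hd]].
- exact (dense_orbit_nonzero F hab _ f Hd).
(* All shifts of [universal n] stay exponentially bounded, so every power is defined at [f]. *)
- intros m.
  destruct (represents_C_ex F hab _ _ (exp_bounded_shift F 1 _ (n * m) Hu)) as [g Hg].
  exists g; exact (represents_op_pow F hab 1 _ n m f g Hu Hf Hg).
Qed.
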